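(* Let $D$ be a finite simple digraph (no loops, no two arcs with the same tail and the same head; pairs of opposite arcs $(u,v),(v,u)$ are allowed) whose arcs are each colored either blue or red. Write $u \overset{b}{\to} v$ (resp. $u \overset{r}{\to} v$) if $(u,v)$ is an arc of $D$ colored blue (resp. red). Suppose that for all vertices $u,v,w$ of $D$: (i) if $u \overset{b}{\to} v$ and $v \overset{b}{\to} w$, then $u \overset{b}{\to} w$, or ($w \overset{r}{\to} u$ and $w \overset{r}{\to} v$); (ii) if $u \overset{r}{\to} v$ and $v \overset{r}{\to} w$, then $u \overset{r}{\to} w$, or ($v \overset{b}{\to} u$ and $w \overset{b}{\to} u$). Then $D$ has a kernel, and such a kernel can be computed in time polynomial in the size of $D$.
   Context: A subset $S$ of vertices of a digraph is independent if no two vertices of $S$ are joined by an arc. A kernel of $D$ is an independent set $S\subseteq V(D)$ such that every vertex not in $S$ has an outneighbor in $S$. *)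

(* Defs.v *)
From mathcomp Require Import all_boot.

Set Implicit Arguments.
Unset Strict Implicit.
Unset Printing Implicit Defensive.

Inductive color := Blue | Red.

(* [col u v] is meaningful only when [arc u v] holds. Since [arc] is a relation,
   parallel arcs are excluded, while opposite arcs are allowed. *)
Record coldigraph (V : finType) := ColDigraph {
  arc : rel V;
  arc_irr : irreflexive arc;
  col : V -> V -> color
}.

Section Digraph.
Variables (V : finType) (D : coldigraph V).

Definition blue (u v : V) : bool :=
  arc D u v && (if col D u v is Blue then true else false).

Definition red (u v : V) : bool :=
  arc D u v && (if col D u v is Red then true else false).

Definition blue_condition : Prop :=
  forall u v w : V, blue u v -> blue v w -> blue u w \/ (red w u /\ red w v).

Definition red_condition : Prop :=
  forall u v w : V, red u v -> red v w -> red u w \/ (blue v u /\ blue w u).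

Definition independent (S : {set V}) : Prop :=
  forall u v : V, u \in S -> v \in S -> ~~ arc D u v.

Definition is_kernel (S : {set V}) : Prop :=
  independent S /\ (forall u : V, u \notin S -> exists2 v, v \in S & arc D u v).

Definition digraph_size : nat := #|V| + #|[set a : V * V | arc D a.1 a.2]|.

Definition arc_code (u v : V) : nat :=
  if blue u v then 1 else if red u v then 2 else 0.

(* The number of vertices, followed by the coloured adjacency matrix in
   row-major order. *)
Definition encode : seq nat :=
  #|V| :: [seq arc_code u v | u <- enum V, v <- enum V].

Definition encode_set (S : {set V}) : seq nat :=
  [seq nat_of_bool (v \in S) | v <- enum V].

End Digraph.

(* The model of computation is the random access machine: registers, an
   indirectly addressed memory and structured control flow. Every elementary
   instruction and every test costs one step. Addition and truncated
   subtraction are the only arithmetic operations (there is no multiplication),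
   so a number computed in t steps has O(t + log N) bits, N bounding the input
   and the constants of the program; hence polynomial time in this model is
   polynomial time on Turing machines. *)
Inductive cmd :=
  | Skip
  | Const (r c : nat)        (* r := c *)
  | Add (r r1 r2 : nat)      (* r := r1 + r2 *)
  | Sub (r r1 r2 : nat)      (* r := r1 - r2 *)
  | Read (r a : nat)         (* r := mem[a] *)
  | Write (a r : nat)        (* mem[a] := r *)
  | Seq (p q : cmd)
  | If (r : nat) (p q : cmd) (* p if r is nonzero, q otherwise *)
  | While (r : nat) (p : cmd).

Record state := State { reg : nat -> nat; mem : nat -> nat }.

Definition upd (f : nat -> nat) (a x : nat) : nat -> nat :=
  fun b => if b == a then x else f b.

Definition set_reg (s : state) (r x : nat) : state :=
  State (upd (reg s) r x) (mem s).

Definition set_mem (s : state) (a x : nat) : state :=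
  State (reg s) (upd (mem s) a x).

(* [exec p s t s']: started in [s], [p] halts in [s'] after [t] steps. *)
Inductive exec : cmd -> state -> nat -> state -> Prop :=
  | ExecSkip s : exec Skip s 1 s
  | ExecConst r c s : exec (Const r c) s 1 (set_reg s r c)
  | ExecAdd r r1 r2 s :
      exec (Add r r1 r2) s 1 (set_reg s r (reg s r1 + reg s r2))
  | ExecSub r r1 r2 s :
      exec (Sub r r1 r2) s 1 (set_reg s r (reg s r1 - reg s r2))
  | ExecRead r a s : exec (Read r a) s 1 (set_reg s r (mem s (reg s a)))
  | ExecWrite a r s : exec (Write a r) s 1 (set_mem s (reg s a) (reg s r))
  | ExecSeq p q s1 t1 s2 t2 s3 :
      exec p s1 t1 s2 -> exec q s2 t2 s3 -> exec (Seq p q) s1 (t1 + t2) s3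
  | ExecIfT r p q s t s' :
      reg s r != 0 -> exec p s t s' -> exec (If r p q) s t.+1 s'
  | ExecIfF r p q s t s' :
      reg s r = 0 -> exec q s t s' -> exec (If r p q) s t.+1 s'
  | ExecWhileT r p s1 t1 s2 t2 s3 :
      reg s1 r != 0 -> exec p s1 t1 s2 -> exec (While r p) s2 t2 s3 ->
      exec (While r p) s1 (t1 + t2).+1 s3
  | ExecWhileF r p s : reg s r = 0 -> exec (While r p) s 1 s.

(* All registers, and all memory cells beyond the input, start at 0. *)
Definition initial_state (input : seq nat) : state :=
  State (fun=> 0) (nth 0 input).

(* The output occupies the first memory cells. *)
Definition outputs_within (p : cmd) (input output : seq nat) (b : nat) : Prop :=
  exists t s, [/\ exec p (initial_state input) t s,
                  mkseq (mem s) (size output) = output & t <= b].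

(* Main.v *)
From mathcomp Require Import all_boot.
Require Import Defs.

(* Call an independent set [S] a semikernel if every red out-neighbour of [S]
   has an arc into [S]. Start from the empty set. While some vertices have no
   arc into [S], pick among them a vertex [x] without red arc to another one of
   them (red arcs form no cycle), discard from [S] the vertices with a blue arc
   to [x], and add [x]. The two conditions make the result a semikernel again,
   and a discarded vertex keeps a blue arc into [S] forever, so it never comes
   back. Hence the process stops after at most [#|V|] rounds, with a kernel. *)

Set Implicit Arguments.
Unset Strict Implicit.
Unset Printing Implicit Defensive.

(** * Semikernels *)

Section Kernel.
Variables (V : finType) (D : coldigraph V).
Hypotheses (blueD : blue_condition D) (redD : red_condition D).

Lemma blue_arc u v : blue D u v -> arc D u v.
Proof. by case/andP. Qed.

Lemma red_arc u v : red D u v -> arc D u v.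
Proof. by case/andP. Qed.

Lemma arc_blue_red u v : arc D u v -> blue D u v \/ red D u v.
Proof. by rewrite /blue /red => ->; case: (col D u v); [left | right]. Qed.

Lemma blue_red u v : blue D u v -> red D u v = false.
Proof. by rewrite /blue /red => /andP[->]; case: (col D u v). Qed.

Lemma red_irr u : red D u u = false.
Proof. by rewrite /red arc_irr. Qed.

(** * Acyclicity of the red arcs *)

Definition red_sink (X : {set V}) (x : V) : bool :=
  (x \in X) && [forall y in X, ~~ red D x y].

Lemma red_sinkP (X : {set V}) x :
  reflect (x \in X /\ forall y, y \in X -> ~~ red D x y) (red_sink X x).
Proof. by apply: (iffP andP) => -[xX /forall_inP]. Qed.

Lemma not_red_sink (X : {set V}) x :
  x \in X -> ~~ red_sink X x -> exists2 y, y \in X & red D x y.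
Proof.
rewrite /red_sink => -> /forallPn[y]; rewrite negb_imply negbK => /andP[yX xy].
by exists y.
Qed.

(* A minimal set [X] without red sink is an induced red cycle. If [y] is a
   vertex of it whose only red out-neighbour is [x], then following the cycle
   from [x] shows that every other vertex has a blue arc to [y], although the
   predecessor of [y] has a red one. *)
Lemma red_sink_exists (X : {set V}) : X != set0 -> exists x, red_sink X x.
Proof.
have [m] := ubnP #|X|; elim: m X => // m IHm X leXm X0.
apply/existsP; apply: contraT => /existsPn noX.
have sinkY (Y : {set V}) : Y \proper X -> Y != set0 -> exists y, red_sink Y y.
  by move=> /proper_card ltYX; apply: IHm; apply: leq_trans ltYX _.
have outX x : x \in X -> exists2 y, y \in X & red D x y.
  by move=> xX; apply: not_red_sink (noX x).
(* By minimality [X :\ x] has a red sink; within [X] its only red arc goes to [x]. *)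
have predX x : x \in X ->
    exists y, [/\ y \in X, red D y x & forall z, z \in X -> red D y z -> z = x].
  move=> xX; have [y yX xy] := outX x xX.
  have [||w /red_sinkP[]] := sinkY (X :\ x).
  - exact: properD1.
  - apply/set0Pn; exists y; rewrite !inE yX andbT.
    by apply: contraTneq xy => ->; rewrite red_irr.
  rewrite !inE => /andP[wx wX] sw; exists w.
  have only z : z \in X -> red D w z -> z = x.
    move=> zX wz; apply/eqP; apply: contraTT wz => zx.
    by apply: sw; rewrite !inE zx.
  by have [z zX wz] := outX w wX; rewrite -{1}(only z zX wz).
have [x xX] := set0Pn _ X0.
have [y [yX yx only_y]] := predX x xX.
have [w [wX wy _]] := predX y yX.
pose Z := [set z in X | (z != y) && ~~ blue D z y].
suff Z0 : Z = set0.
  have : w \notin Z by rewrite Z0 inE.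
  rewrite !inE wX /= negb_and !negbK => /orP[/eqP wyE | /blue_red].
    by rewrite wyE red_irr in wy.
  by rewrite wy.
apply/eqP; apply: contraT => /set0Pn[z0]; rewrite inE => /andP[z0X z0P].
(* For nonempty [Z] the set [X :\: Z] is smaller than [X], and within [X] its red sink [g] sends red
   arcs only into [Z]. *)
have [||g /red_sinkP[]] := sinkY (X :\: Z).
- apply/properP; split; first exact: subsetDl.
  by exists z0 => //; rewrite !inE z0X z0P.
- by apply/set0Pn; exists y; rewrite !inE yX eqxx.
rewrite inE => /andP[gZ gX] sg.
pose O := [set z in X | red D g z].
have [||z /red_sinkP[]] := sinkY O.
- apply/properP; split; first by apply/subsetP=> z; rewrite inE => /andP[].
  by exists g; rewrite // inE red_irr andbF.
- by have [z zX gz] := outX g gX; apply/set0Pn; exists z; rewrite inE zX.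
rewrite inE => /andP[zX gz] sz.
have zZ : z \in Z.
  by apply: contraTT gz => zZ; apply: sg; rewrite inE zZ.
have [z' z'X zz'] := outX z zX.
(* The red successor [z'] of [z] lies outside [O], where [z] is a red sink, so condition (ii) on
   [g], [z], [z'] leaves only its blue alternative. *)
have zg : blue D z g.
  case: (redD gz zz') => [gz' | []] //.
  by have := sz z'; rewrite inE z'X gz' zz' => /(_ isT).
move: zZ; rewrite !inE zX /= => /andP[zy nzy].
have [gy | gy] := eqVneq g y; first by rewrite -gy zg in nzy.
have bgy : blue D g y by move: gZ; rewrite inE gX gy /= negbK.
(* The red alternative of (i) would make both [z] and [g] equal to [x], the only red out-neighbour
   of [y], and the red arc from [g] to [z] a loop. *)
case: (blueD zg bgy) => [zyb | [yz yg]]; first by rewrite zyb in nzy.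
by rewrite (only_y z zX yz) (only_y g gX yg) red_irr in gz.
Qed.

(** * Absorption and the exchange step *)

Definition unabsorbed (S : {set V}) : {set V} :=
  [set x | (x \notin S) && [forall v in S, ~~ arc D x v]].

Lemma unabsorbedP (S : {set V}) x :
  reflect (x \notin S /\ forall v, v \in S -> ~~ arc D x v) (x \in unabsorbed S).
Proof. by rewrite inE; apply: (iffP andP) => -[xS /forall_inP]. Qed.

Lemma absorbed (S : {set V}) x : x \notin S -> x \notin unabsorbed S ->
  exists2 v, v \in S & arc D x v.
Proof.
rewrite inE => -> /forallPn[v]; rewrite negb_imply negbK => /andP[vS xv].
by exists v.
Qed.

(* [R] is the set of all the vertices that have ever been in [S]; a discarded
   vertex never comes back, since it stays absorbed through a blue arc. *)
Definition semikernel (S R : {set V}) : Prop :=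
  [/\ independent D S,
      forall s z, s \in S -> red D s z -> exists2 v, v \in S & arc D z v &
      forall r, r \in R -> r \notin S -> exists2 v, v \in S & blue D r v].

Definition exchange (S : {set V}) (x : V) : {set V} :=
  x |: [set s in S | ~~ blue D s x].

Lemma semikernel0 : semikernel set0 set0.
Proof. by split=> [u v | s z | r]; rewrite inE. Qed.

(** A vertex of [R] outside [S] is absorbed through a blue arc. Hence every exchange enlarges [R],
    which bounds the number of exchanges by [#|V|]. *)
Lemma semikernel_fresh S R x :
  semikernel S R -> x \in unabsorbed S -> x \notin R.
Proof.
case=> _ _ kR /unabsorbedP[xS xN]; apply/negP => /kR/(_ xS)[v vS /blue_arc xv].
by rewrite (negPf (xN v vS)) in xv.
Qed.

(** The new vertex [x] takes over from each discarded [v]: a blue arc into [v] extends along the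
    blue arc from [v] to [x], and a red one is handled by condition (ii). *)
Lemma semikernel_exchange S R x : semikernel S R ->
  red_sink (unabsorbed S) x -> semikernel (exchange S x) (x |: R).
Proof.
move=> [indS redS kR] /red_sinkP[xU sinkx].
have /unabsorbedP[xS xN] := xU.
have xin : x \in exchange S x by rewrite !inE eqxx.
have stay v : v \in S -> v \in exchange S x \/ blue D v x.
  by move=> vS; rewrite !inE vS; case: blue; [right | left; rewrite orbT].
have nred v : v \in S -> ~~ red D x v.
  by move=> vS; apply: contra (xN v vS) => /red_arc.
(* The other alternative of (i) contains a red arc from [x] to [v], but [x] has no arc into [S]. *)
have through r v : v \in S -> blue D v x -> blue D r v -> blue D r x.
  move=> vS vx rv; case: (blueD rv vx) => // -[_ xv].
  by rewrite (negPf (nred v vS)) in xv.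
split.
- move=> u v; rewrite !inE => /orP[/eqP-> | /andP[uS ux]].
    move=> /orP[/eqP-> | /andP[vS _]]; first by rewrite arc_irr.
    exact: xN.
  move=> /orP[/eqP-> {v} | /andP[vS _]]; last exact: indS.
  apply/negP => /arc_blue_red[ux' | /(redS u x uS)[v vS xv]].
    by rewrite ux' in ux.
  by rewrite (negPf (xN v vS)) in xv.
- move=> t z tS' tz.
  (* Absorption by the old [S] suffices. If the absorber [v] was discarded and the arc from [z] to
     [v] is red, then (ii) on [t], [z], [v] yields an arc that cannot exist, or else [t = x] and a
     blue arc from [z] to [x]. *)
  suff [v vS zv] : exists2 v, v \in S & arc D z v.
    have [vS' | vx] := stay v vS; first by exists v.
    exists x => //; apply: blue_arc.
    case: (arc_blue_red zv) => [/through-> // | rzv].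
    case: (redD tz rzv).
      move: tS'; rewrite !inE => /orP[/eqP-> | /andP[tS _]].
        by rewrite (negPf (nred v vS)).
      by move=> /red_arc tv; rewrite (negPf (indS t v tS vS)) in tv.
    move=> [zt vt].
    move: tS'; rewrite !inE => /orP[/eqP<- // | /andP[tS _]].
    by have := indS v t vS tS; rewrite blue_arc.
  (* For [t = x], the vertex [z] is not in [S], into which [x] has no arc, and it is absorbed
     because [x] is a red sink of the unabsorbed vertices. *)
  move: tS'; rewrite !inE => /orP[/eqP txE | /andP[tS _]]; last exact: redS tz.
  rewrite txE in tz; apply: absorbed.
    by apply: contraL tz => /nred.
  by apply: contraL tz => /sinkx.
- move=> r; rewrite 2!inE => /orP[/eqP-> | rR rS']; first by rewrite xin.
  have [rS | rS] := boolP (r \in S).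
    by have [rin | rx] := stay r rS; [rewrite rin in rS' | exists x].
  have [v vS rv] := kR r rR rS.
  have [vS' | vx] := stay v vS; first by exists v.
  by exists x => //; apply: through rv.
Qed.

Lemma semikernel_kernel S R :
  semikernel S R -> unabsorbed S = set0 -> is_kernel D S.
Proof.
case=> indS _ _ U0; split=> // u uS.
by apply: absorbed; rewrite // U0 inE.
Qed.

End Kernel.

(** * Verification rules for the machine *)

Fixpoint writes (p : cmd) (r : nat) : bool :=
  match p with
  | Skip | Write _ _ => false
  | Const r' _ | Add r' _ _ | Sub r' _ _ | Read r' _ => r' == r
  | Seq p q | If _ p q => writes p r || writes q r
  | While _ p => writes p r
  end.

Fixpoint stores (p : cmd) : bool :=
  match p with
  | Write _ _ => true
  | Seq p q | If _ p q => stores p || stores q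
  | While _ p => stores p
  | _ => false
  end.

(** The frame condition: registers are tracked one by one, the memory only as a whole. Its syntactic
    tests are settled by computation on concrete programs. *)
Definition kept (p : cmd) (s s' : state) : Prop :=
  (forall r, ~~ writes p r -> reg s' r = reg s r) /\
  (~~ stores p -> mem s' = mem s).

Lemma kept_refl p s : kept p s s.
Proof. by []. Qed.

Lemma kept_trans p s1 s2 s3 : kept p s1 s2 -> kept p s2 s3 -> kept p s1 s3.
Proof.
move=> [r12 m12] [r23 m23]; split=> [r nr | np]; first by rewrite r23 ?r12.
by rewrite m23 ?m12.
Qed.

Lemma kept_sub p q s s' : (forall r, writes p r -> writes q r) ->
  (stores p -> stores q) -> kept p s s' -> kept q s s'.
Proof.
move=> subw subs [kr km]; split=> [r nr | nq].
  by apply: kr; apply: contra nr; apply: subw.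
by apply: km; apply: contra nq.
Qed.

Lemma kept_set_reg p s r x : writes p r -> kept p s (set_reg s r x).
Proof.
by move=> wr; split=> // r' nr'; rewrite /= /upd ifN //; apply: contraNneq nr' => ->.
Qed.

Lemma exec_kept p s t s' : exec p s t s' -> kept p s s'.
Proof.
elim=> {p s t s'} //; try by move=> *; apply: kept_set_reg; rewrite /= eqxx.
- move=> p q s1 t1 s2 t2 s3 _ k12 _ k23; apply: (@kept_trans _ _ s2).
    by apply: kept_sub k12 => /= [r|] ->.
  by apply: kept_sub k23 => /= [r|] ->; rewrite orbT.
- by move=> r p q s t s' _ _; apply: kept_sub => /= [r'|] ->.
- by move=> r p q s t s' _ _; apply: kept_sub => /= [r'|] ->; rewrite orbT.
- by move=> r p s1 t1 s2 t2 s3 _ _ + _; apply: kept_trans.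
Qed.

(* A bound on the running time of [p], provided that every execution of a loop
   of [p] makes at most [n] iterations. *)
Fixpoint cost (n : nat) (p : cmd) : nat :=
  match p with
  | Seq p q => cost n p + cost n q
  | If _ p q => (cost n p + cost n q).+1
  | While _ p => (n * (cost n p).+1).+1
  | _ => 1
  end.

(** Bounds [c * n.+1 ^ k] are closed under sums, and a loop raises the exponent by one. The positive
    base [n.+1] makes them monotone in [k] even at [n = 0]. *)
Lemma cost_poly p : exists c k, forall n, cost n p <= c * n.+1 ^ k.
Proof.
have const : exists c k, forall n, 1 <= c * n.+1 ^ k by exists 1, 0.
have sum (f g : nat -> nat) : (exists c k, forall n, f n <= c * n.+1 ^ k) ->
    (exists c k, forall n, g n <= c * n.+1 ^ k) ->
    exists c k, forall n, f n + g n <= c * n.+1 ^ k.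
  move=> [c [k lef]] [d [l leg]]; exists (c + d), (k + l) => n.
  rewrite mulnDl; apply: leq_add.
    by apply: leq_trans (lef n) _; rewrite leq_mul2l leq_pexp2l ?leq_addr ?orbT.
  by apply: leq_trans (leg n) _; rewrite leq_mul2l leq_pexp2l ?leq_addl ?orbT.
elim: p => //= [p IHp q IHq | _ p IHp q IHq | _ p IHp].
- exact: sum.
- by have [c [k le]] := sum _ _ const (sum _ _ IHp IHq); exists c, k.
- have [c [k le]] : exists c k, forall n, 1 + n * (1 + cost n p) <= c * n.+1 ^ k.
    apply: (sum _ _ const _); have [c [k le]] := sum _ _ const IHp.
    by exists c, k.+1 => n; rewrite expnS mulnCA leq_mul.
  by exists c, k.
Qed.

Section Runs.
Variable n : nat.

(** Total correctness in weakest-precondition style, with the time bound built in. *)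
Definition runs (p : cmd) (s : state) (Q : state -> Prop) : Prop :=
  exists t s', [/\ exec p s t s', t <= cost n p & Q s'].

Lemma runs_kept p s (Q : state -> Prop) :
  runs p s (fun s' => kept p s s' -> Q s') -> runs p s Q.
Proof.
by move=> [t [s' [ex le Qs']]]; exists t, s'; split=> //; apply/Qs'/exec_kept/ex.
Qed.

Lemma runs_skip s (Q : state -> Prop) : Q s -> runs Skip s Q.
Proof. by exists 1, s; split=> //; apply: ExecSkip. Qed.

Lemma runs_const r c s (Q : state -> Prop) :
  Q (set_reg s r c) -> runs (Const r c) s Q.
Proof. by exists 1, (set_reg s r c); split=> //; apply: ExecConst. Qed.

Lemma runs_add r r1 r2 s (Q : state -> Prop) :
  Q (set_reg s r (reg s r1 + reg s r2)) -> runs (Add r r1 r2) s Q.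
Proof. by move=> Qs; do 2!eexists; split; [apply: ExecAdd | | apply: Qs]. Qed.

Lemma runs_sub r r1 r2 s (Q : state -> Prop) :
  Q (set_reg s r (reg s r1 - reg s r2)) -> runs (Sub r r1 r2) s Q.
Proof. by move=> Qs; do 2!eexists; split; [apply: ExecSub | | apply: Qs]. Qed.

Lemma runs_read r a s (Q : state -> Prop) :
  Q (set_reg s r (mem s (reg s a))) -> runs (Read r a) s Q.
Proof. by move=> Qs; do 2!eexists; split; [apply: ExecRead | | apply: Qs]. Qed.

Lemma runs_write a r s (Q : state -> Prop) :
  Q (set_mem s (reg s a) (reg s r)) -> runs (Write a r) s Q.
Proof. by move=> Qs; do 2!eexists; split; [apply: ExecWrite | | apply: Qs]. Qed.

Lemma runs_seq p q s Q : runs p s (fun s' => runs q s' Q) -> runs (Seq p q) s Q.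
Proof.
move=> [t1 [s1 [ex1 le1 [t2 [s2 [ex2 le2 Qs2]]]]]].
by exists (t1 + t2), s2; split; rewrite /= ?leq_add //; apply: ExecSeq ex1 ex2.
Qed.

Lemma runs_if r p q s Q :
  (reg s r != 0 -> runs p s Q) -> (reg s r = 0 -> runs q s Q) ->
  runs (If r p q) s Q.
Proof.
move=> Hp Hq; have [r0 | r0] := eqVneq (reg s r) 0.
  have [t [s' [ex le Qs']]] := Hq r0; exists t.+1, s'; split=> //=.
    exact: ExecIfF.
  by rewrite ltnS (leq_trans le) ?leq_addl.
have [t [s' [ex le Qs']]] := Hp r0; exists t.+1, s'; split=> //=.
  exact: ExecIfT.
by rewrite ltnS (leq_trans le) ?leq_addr.
Qed.

(** The index of [J] is the value of the loop register and counts the remaining iterations; it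
    starts at most at [n], as [cost] presupposes. *)
Lemma runs_while r p (J : nat -> state -> Prop) k s (Q : state -> Prop) :
  k <= n -> (forall k s, J k s -> reg s r = k) ->
  (forall k s, k < n -> J k.+1 s -> runs p s (J k)) ->
  J k s -> (forall s', J 0 s' -> Q s') -> runs (While r p) s Q.
Proof.
move=> lekn Jr Jp Jk JQ.
suff [t [s' [ex le J0]]] : exists t s',
    [/\ exec (While r p) s t s', t <= (k * (cost n p).+1).+1 & J 0 s'].
  exists t, s'; split=> //; last exact: JQ.
  by apply: leq_trans le _; rewrite ltnS leq_mul.
elim: k lekn s Jk => [_|k IHk ltkn] s Jk.
  by exists 1, s; split=> //; apply: ExecWhileF; apply: Jr Jk.
have [t1 [s1 [ex1 le1 /(IHk (ltnW ltkn))[t2 [s2 [ex2 le2 J0]]]]]] := Jp k s ltkn Jk.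
exists (t1 + t2).+1, s2; split=> //.
  by apply: ExecWhileT ex1 ex2; rewrite (Jr _ _ Jk).
by rewrite ltnS mulSn addSnnS leq_add.
Qed.

End Runs.

(** * The program *)

(* [nN], [one] and [zero] hold the number [n] of vertices, 1 and 0;
   [baseS] and [baseX] hold the addresses [1 + n * n] and [1 + n * n + n] of two
   bit arrays, placed behind the input, for [S] and the set of the vertices that
   [S] does not absorb. [pick] holds [0] or one plus the index of a vertex. *)
Local Notation nN := 0.
Local Notation one := 1.
Local Notation zero := 2.
Local Notation baseS := 3.
Local Notation baseX := 4.
Local Notation rounds := 5.
Local Notation i := 6.
Local Notation rowi := 7.
Local Notation j := 8.
Local Notation rowj := 9.
Local Notation flag := 10.
Local Notation tmp := 11.
Local Notation addr := 12.
Local Notation pick := 13.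

(* Runs [body] for [k] from [n - 1] down to [0]; [row] is then [1 + k * n], the address
   of the first entry of row [k] of the matrix. *)
Definition For (k row : nat) (body : cmd) : cmd :=
  Seq (Add k nN zero) (Seq (Add row baseS zero)
    (While k (Seq (Sub k k one) (Seq (Sub row row nN) body)))).

Definition find_unabsorbed : cmd :=
  For i rowi
    (Seq (Add addr baseS i) (Seq (Read tmp addr) (Seq (Sub flag one tmp)
    (Seq (For j rowj
      (Seq (Add addr baseS j) (Seq (Read tmp addr)
        (If tmp
          (Seq (Add addr rowi j) (Seq (Read tmp addr)
            (If tmp (Const flag 0) Skip)))
          Skip))))
    (Seq (Add addr baseX i) (Write addr flag)))))).

Definition find_red_sink : cmd :=
  Seq (Const pick 0)
  (For i rowi
    (Seq (Add addr baseX i) (Seq (Read flag addr)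
    (Seq (For j rowj
      (Seq (Add addr baseX j) (Seq (Read tmp addr)
        (If tmp
          (Seq (Add addr rowi j) (Seq (Read tmp addr) (Seq (Sub tmp tmp one)
            (If tmp (Const flag 0) Skip))))
          Skip))))
    (If flag (Add pick i one) Skip))))).

Definition do_exchange : cmd :=
  If pick
    (Seq (Sub pick pick one)
    (Seq (For i rowi
      (Seq (Add addr rowi pick) (Seq (Read tmp addr)
        (If tmp
          (Seq (Sub tmp tmp one)
            (If tmp Skip (Seq (Add addr baseS i) (Write addr zero))))
          Skip))))
    (Seq (Add addr baseS pick) (Write addr one))))
    Skip.

Definition setup : cmd :=
  Seq (Read nN zero) (Seq (Const one 1) (Seq (Const baseS 1)
  (Seq (Add rounds nN zero)
  (Seq (While rounds (Seq (Sub rounds rounds one) (Add baseS baseS nN)))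
       (Add baseX baseS nN))))).

Definition output : cmd :=
  For i rowi (Seq (Add addr baseS i) (Seq (Read tmp addr) (Write i tmp))).

Definition kernel_prog : cmd :=
  Seq setup (Seq (Add rounds nN zero)
  (Seq (While rounds
    (Seq (Sub rounds rounds one)
      (Seq find_unabsorbed (Seq find_red_sink do_exchange))))
  output)).

(** * Correctness of the program *)

Section Correctness.
Variables (V : finType) (D : coldigraph V).

Local Notation n := #|V|.

Definition rank (v : V) : nat := enum_rank v.

Lemma rank_lt v : rank v < n.
Proof. exact: ltn_ord. Qed.


Definition env (s : state) : Prop :=
  [/\ reg s nN = n, reg s one = 1, reg s zero = 0,
      reg s baseS = 1 + n * n & reg s baseX = 1 + n * n + n].

(** [iota 0 5] lists the registers fixed by [env]. *)
Definition keeps_env (p : cmd) : bool := all (fun r => ~~ writes p r) (iota 0 5).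

Lemma env_kept p s s' : kept p s s' -> env s -> keeps_env p -> env s'.
Proof.
move=> [kr _] [e0 e1 e2 e3 e4] /allP kp.
by split; rewrite kr // kp.
Qed.

Lemma upd_eq f a x : upd f a x a = x.
Proof. by rewrite /upd eqxx. Qed.

Lemma upd_neq f a x b : b != a -> upd f a x b = f b.
Proof. by rewrite /upd => /negPf->. Qed.

(** The invariant sees only the memory and one accumulator; the frame condition supplies the rest.
    [I m] describes the state once the vertices of rank at least [m] are treated. *)
Lemma runs_for (k row acc : nat) body (I : nat -> (nat -> nat) -> nat -> Prop) s Q :
  env s -> keeps_env (For k row body) ->
  [&& k != row, acc != k, acc != row, ~~ writes body k & ~~ writes body row] ->
  I n (mem s) (reg s acc) ->
  (forall v s', kept (For k row body) s s' -> reg s' k = rank v ->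
     reg s' row = 1 + rank v * n -> I (rank v).+1 (mem s') (reg s' acc) ->
     runs n body s' (fun s'' => I (rank v) (mem s'') (reg s'' acc))) ->
  (forall s', kept (For k row body) s s' -> I 0 (mem s') (reg s' acc) -> Q s') ->
  runs n (For k row body) s Q.
Proof.
set F := For k row body => es kF /and5P[krow acck accrow wk wrow] In body_ok Q_ok.
have Fk : writes F k by rewrite /= eqxx.
have Frow : writes F row by rewrite /= eqxx orbT.
have Fbody s1 s2 : kept body s1 s2 -> kept F s1 s2.
  by apply: kept_sub => [r|] /= ->; rewrite ?orbT.
have set_k s' x : kept F s s' -> kept F s (set_reg s' k x).
  by move=> ks; apply: kept_trans ks _; apply: kept_set_reg.
have set_row s' x : kept F s s' -> kept F s (set_reg s' row x).
  by move=> ks; apply: kept_trans ks _; apply: kept_set_reg.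
have low r : writes F r -> r \notin iota 0 5.
  by move=> wr; apply/negP => /(allP kF); rewrite wr.
have := low _ Fk; have := low _ Frow.
rewrite !inE !negb_or => /and5P[row0 row1 row2 row3 _] /and5P[k0 k1 k2 k3 _].
pose J m s' := [/\ m <= n, kept F s s', reg s' k = m, reg s' row = 1 + m * n &
  I m (mem s') (reg s' acc)].
case: (es) => e0 e1 e2 e3 _.
apply: runs_seq; apply: runs_add; apply: runs_seq; apply: runs_add.
apply: (@runs_while _ _ _ J n); rewrite ?leqnn //.
- by move=> m s' [].
- move=> m s' ltmn [lem ks sk srow Im].
  have [f0 f1 f2 f3 _] := env_kept ks es kF.
  apply: runs_seq; apply: runs_sub; apply: runs_seq; apply: runs_sub.
  pose v := enum_val (Ordinal ltmn).
  have vm : rank v = m by rewrite /rank enum_valK.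
  apply: runs_kept; rewrite -vm.
  set s1 := set_reg _ _ _.
  have k1s : kept F s s1 by apply: set_row; apply: set_k.
  have s1k : reg s1 k = rank v.
    by rewrite /= upd_neq // upd_eq sk f1 vm subn1.
  have s1row : reg s1 row = 1 + rank v * n.
    rewrite /= upd_eq !upd_neq 1?eq_sym // srow f0.
    by rewrite vm mulSnr addnA addnK.
  have s1acc : I (rank v).+1 (mem s1) (reg s1 acc).
    by rewrite /= !upd_neq ?vm.
  have [t [s2 [ex le I2]]] := body_ok v s1 k1s s1k s1row s1acc.
  exists t, s2; split=> // k12.
  have [kr _] := k12.
  split; rewrite ?(kr k) ?(kr row) //; first by apply/ltnW/rank_lt.
  exact: kept_trans k1s (Fbody _ _ k12).
- split=> //=.
  + by apply: set_row; apply: set_k; apply: kept_refl.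
  + by rewrite upd_neq // upd_eq e0 e2 addn0.
  + by rewrite upd_eq !upd_neq 1?eq_sym // e3 e2 addn0.
  + by rewrite !upd_neq.
- by move=> s' [_ ks _ _ I0]; apply: Q_ok.
Qed.

(** * Memory layout *)

Definition layout (S X : {set V}) (m : nat -> nat) : Prop :=
  [/\ forall u v, m (1 + rank u * n + rank v) = arc_code D u v,
      forall u, m (1 + n * n + rank u) = (u \in S) &
      forall u, m (1 + n * n + n + rank u) = (u \in X)].

Lemma matrix_lt (u v : V) : rank u * n + rank v < n * n.
Proof.
apply: (@leq_trans ((rank u).+1 * n)); last by rewrite leq_mul2r rank_lt orbT.
by rewrite mulSnr ltn_add2l rank_lt.
Qed.

Lemma rank_inj (u v : V) : (rank u == rank v) = (u == v).
Proof. by rewrite /rank (inj_eq val_inj) (inj_eq enum_rank_inj). Qed.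

Lemma layout_setS (S S' X : {set V}) m v (b : bool) : layout S X m ->
  (forall u, (u \in S') = if u == v then b else u \in S) ->
  layout S' X (upd m (1 + n * n + rank v) b).
Proof.
move=> [mD mS mX] S'E; split=> [u w | u | u].
- by rewrite upd_neq // neq_ltn -!addnA ltn_add2l ltn_addr ?matrix_lt.
- by rewrite S'E /upd eqn_add2l rank_inj; case: eqP => // _; rewrite mS.
- by rewrite upd_neq // neq_ltn orbC -!addnA !ltn_add2l ltn_addr ?rank_lt.
Qed.

Lemma layout_setX (S X X' : {set V}) m v (b : bool) : layout S X m ->
  (forall u, (u \in X') = if u == v then b else u \in X) ->
  layout S X' (upd m (1 + n * n + n + rank v) b).
Proof.
move=> [mD mS mX] X'E; split=> [u w | u | u].
- by rewrite upd_neq // neq_ltn -!addnA ltn_add2l ltn_addr ?matrix_lt.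
- by rewrite upd_neq // neq_ltn -!addnA !ltn_add2l ltn_addr ?rank_lt.
- by rewrite X'E /upd eqn_add2l rank_inj; case: eqP => // _; rewrite mX.
Qed.

Lemma arc_code0 u v : (arc_code D u v != 0) = arc D u v.
Proof. by rewrite /arc_code /blue /red; case: arc => //=; case: col. Qed.

(** Among the codes 0, 1, 2 only that of red survives truncated subtraction of 1, which is how the
    program tests colours. *)
Lemma arc_code_red u v : (arc_code D u v - 1 != 0) = red D u v.
Proof. by rewrite /arc_code /blue /red; case: arc => //=; case: col. Qed.

Lemma arc_code_blue u v : (arc_code D u v == 1) = blue D u v.
Proof. by rewrite /arc_code /blue /red; case: arc => //=; case: col. Qed.

(** This lemma and the next two start, advance and finish the evaluation of a universal quantifier
    by a descending loop. *)
Lemma forall_rank_n (P : pred V) : [forall w, (n <= rank w) ==> P w].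
Proof. by apply/forallP=> w; rewrite leqNgt rank_lt. Qed.

Lemma forall_rank_step (P : pred V) v :
  [forall w, (rank v <= rank w) ==> P w] =
  P v && [forall w, (rank v < rank w) ==> P w].
Proof.
apply/forallP/andP=> [Pw | [Pv /forallP Pw] w].
  split; first by have := Pw v; rewrite leqnn.
  by apply/forallP=> w; apply/implyP => /ltnW; apply/implyP.
rewrite leq_eqVlt rank_inj.
by case: eqVneq => [<- | _]; [rewrite Pv | apply: Pw].
Qed.

Lemma forall_rank_0 (P : pred V) :
  [forall w, (0 <= rank w) ==> P w] = [forall w, P w].
Proof. by apply: eq_forallb. Qed.

(** * Correctness of the subroutines *)

Local Ltac run :=
  repeat lazymatch goal with
  | |- runs _ (Seq _ _) _ _ => apply: runs_seq
  | |- runs _ (Add _ _ _) _ _ => apply: runs_add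
  | |- runs _ (Sub _ _ _) _ _ => apply: runs_sub
  | |- runs _ (Read _ _) _ _ => apply: runs_read
  | |- runs _ (Const _ _) _ _ => apply: runs_const
  end;
  rewrite /= /upd /=.

Lemma find_unabsorbed_ok S X s Q : env s -> layout S X (mem s) ->
  (forall s', kept find_unabsorbed s s' ->
     layout S (unabsorbed D S) (mem s') -> Q s') ->
  runs n find_unabsorbed s Q.
Proof.
move=> es ls Qs.
(* [Y] is the content of the array being overwritten, already right from rank [k] on. *)
pose I k m (a : nat) := exists2 Y, layout S Y m &
  forall u, k <= rank u -> (u \in Y) = (u \in unabsorbed D S).
apply: (@runs_for _ _ tmp _ I) => //.
- by exists X => // u; rewrite leqNgt rank_lt.
- move=> u s1 ks1 i1 row1 [Y lY YU].
  have e1 := env_kept ks1 es isT.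
  have [_ e_one _ e_S _] := e1.
  have [mD mS _] := lY.
  run; set s2 := set_reg _ _ _.
  pose P w := (w \in S) ==> ~~ arc D u w.
  pose In k (m : nat -> nat) a :=
    a = (u \notin S) && [forall w, (k <= rank w) ==> P w] :> nat.
  apply: (@runs_for _ _ flag _ In) => //.
  + by rewrite /In forall_rank_n /= /upd /= e_one e_S i1 mS; case: (u \in S).
  + move=> v s3 ks3 j3 row3; rewrite /In => I3.
    have [_ _ _ e3_S _] := env_kept ks3 e1 isT.
    have [kr3 /(_ isT) m3] := ks3.
    have rowi3 : reg s3 rowi = 1 + rank u * n by rewrite kr3.
    run; rewrite e3_S j3 m3 mS.
    rewrite forall_rank_step {1}/P.
    apply: runs_if => /=; rewrite {1}/upd /=; case: (v \in S) => //= _.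
      run; rewrite rowi3 j3 m3 mD.
      apply: runs_if => /=; rewrite {1}/upd /=.
        by rewrite arc_code0 => ->; run; rewrite andbF.
      move/eqP; rewrite -[_ == 0]negbK arc_code0 => ->.
      by apply: runs_skip; rewrite /= /upd /= I3.
    by apply: runs_skip; rewrite /= /upd /= I3.
  + move=> s3 ks3; rewrite /In forall_rank_0 => flag3.
    have [_ _ _ _ e3_X] := env_kept ks3 e1 isT.
    have [kr3 /(_ isT) m3] := ks3.
    have i3 : reg s3 i = rank u by rewrite kr3.
    run; apply: runs_write; rewrite /= /upd /= e3_X i3 flag3 m3.
    have -> : (u \notin S) && [forall w, P w] = (u \in unabsorbed D S).
      by rewrite inE.
    exists [set w | if w == u then u \in unabsorbed D S else w \in Y].
      by apply: layout_setX lY _ => w; rewrite inE.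
    move=> w; rewrite leq_eqVlt rank_inj inE.
    by case: (eqVneq w u) => [-> // | _ /YU].
- move=> s' ks [Y lY YU]; apply: Qs => //.
  suff <- : Y = unabsorbed D S by [].
  by apply/setP=> u; apply: YU.
Qed.

Lemma find_red_sink_ok S X s Q : env s -> layout S X (mem s) ->
  (forall s', kept find_red_sink s s' ->
     (if reg s' pick is m.+1 then exists2 v, m = rank v & red_sink D X v
      else forall v, ~~ red_sink D X v) -> Q s') ->
  runs n find_red_sink s Q.
Proof.
move=> es [mD _ mX] Qs; apply: runs_kept; rewrite /find_red_sink.
run; set s0 := set_reg _ _ _.
have e0 : env s0 by [].
pose I k (m : nat -> nat) a :=
  if a is b.+1 then exists2 v, b = rank v & red_sink D X v
  else forall v, k <= rank v -> ~~ red_sink D X v.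
apply: (@runs_for _ _ pick _ I) => //.
- by move=> u; rewrite leqNgt rank_lt.
- move=> u s1 ks1 i1 row1 Ia.
  have e1 := env_kept ks1 e0 isT.
  have [_ e_one _ _ e_X] := e1.
  have m1 : mem s1 = mem s by case: ks1 => _ ->.
  run; set s2 := set_reg _ _ _.
  pose P w := (w \in X) ==> ~~ red D u w.
  pose In k (m : nat -> nat) a :=
    a = (u \in X) && [forall w, (k <= rank w) ==> P w] :> nat.
  apply: (@runs_for _ _ flag _ In) => //.
  + by rewrite /In forall_rank_n /= /upd /= e_X i1 m1 mX andbT.
  + move=> v s3 ks3 j3 row3; rewrite /In => I3.
    have [_ e3_one _ _ e3_X] := env_kept ks3 e1 isT.
    have [kr3 /(_ isT) m3] := ks3.
    have rowi3 : reg s3 rowi = 1 + rank u * n by rewrite kr3.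
    run; rewrite e3_X j3 m3 /= m1 mX.
    rewrite forall_rank_step {1}/P.
    apply: runs_if => /=; rewrite {1}/upd /=; case: (v \in X) => //= _.
      run; rewrite rowi3 j3 m3 /= m1 mD e3_one.
      apply: runs_if => /=; rewrite {1}/upd /=.
        by rewrite arc_code_red => ->; run; rewrite andbF.
      move/eqP; rewrite -[_ == 0]negbK arc_code_red => ->.
      by apply: runs_skip; rewrite /= /upd /= I3.
    by apply: runs_skip; rewrite /= /upd /= I3.
  + move=> s3 ks3; rewrite /In forall_rank_0 => flag3.
    have [_ e3_one _ _ _] := env_kept ks3 e1 isT.
    have [kr3 _] := ks3.
    have i3 : reg s3 i = rank u by rewrite kr3.
    have pick3 : reg s3 pick = reg s1 pick by rewrite kr3.
    have sinkE : (u \in X) && [forall w, P w] = red_sink D X u by [].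
    apply: runs_if; rewrite flag3 sinkE => su.
      run; rewrite i3 e3_one addn1; exists u => //.
      by case: red_sink su.
    apply: runs_skip; rewrite pick3 /I.
    case: (reg s1 pick) Ia => //= noX v; rewrite leq_eqVlt rank_inj.
    by case: eqVneq => [<- _ | _ /noX //]; case: red_sink su.
- by move=> s' _ I0 ks; apply: Qs ks _; case: (reg s' pick) I0 => // noX v; apply: noX.
Qed.

Lemma do_exchange_ok S X s (Q : state -> Prop) : env s -> layout S X (mem s) ->
  (reg s pick = 0 -> Q s) ->
  (forall v s', reg s pick = (rank v).+1 -> kept do_exchange s s' ->
     layout (exchange D S v) X (mem s') -> Q s') ->
  reg s pick <= n ->
  runs n do_exchange s Q.
Proof.
move=> es lS Q0 Qv lep; apply: runs_kept; apply: runs_if; last first.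
  by move=> /Q0 Qs; apply: runs_skip.
rewrite -lt0n => gt0.
have ltp : (reg s pick).-1 < n by rewrite prednK.
pose v := enum_val (Ordinal ltp).
have pv : reg s pick = (rank v).+1 by rewrite /rank enum_valK prednK.
have [_ e_one _ _ _] := es.
run; set s0 := set_reg _ _ _.
have e0 : env s0 by [].
(* These sets descend from [S], at [k = n], to [exchange D S v] before the insertion of [v], at
   [k = 0]. *)
pose T k := [set w in S | ~~ ((k <= rank w) && blue D w v)].
pose I k m (a : nat) := layout (T k) X m.
apply: (@runs_for _ _ tmp _ I) => //.
- rewrite /I; suff -> : T n = S by [].
  by apply/setP=> w; rewrite inE leqNgt rank_lt andbT.
- move=> u s1 ks1 i1 row1 l1.
  have [_ e1_one e1_zero e1_S _] := env_kept ks1 e0 isT.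
  have pick1 : reg s1 pick = rank v.
    by case: ks1 => -> //= _; rewrite /upd /= e_one pv subn1.
  have [mD _ _] := l1.
  run; rewrite row1 pick1 mD.
  have skip : ~~ blue D u v -> T (rank u) = T (rank u).+1.
    move=> uv; apply/setP=> w; rewrite !inE leq_eqVlt rank_inj.
    by case: eqVneq => [<- | _] //=; rewrite (negPf uv) !andbF.
  apply: runs_if; rewrite /= /upd /=.
    move=> c0; run; rewrite e1_one; apply: runs_if; rewrite /= /upd /= => c1.
      apply: runs_skip; rewrite /I /= skip // -arc_code_blue.
      by apply: contra c1 => /eqP->.
    have uv : blue D u v.
      by rewrite -arc_code_blue eqn_leq lt0n c0 andbT -subn_eq0 c1.
    run; apply: runs_write; rewrite /= /upd /= e1_S i1 e1_zero.
    apply: (@layout_setS _ _ _ _ _ false) l1 _ => w; rewrite !inE leq_eqVlt rank_inj.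
    by case: eqVneq => [<- | _] //; rewrite uv andbF.
  move=> c0; apply: runs_skip; rewrite /I /= skip // -arc_code_blue.
  by rewrite c0.
- move=> s1 ks1 l1.
  have [_ e1_one _ e1_S _] := env_kept ks1 e0 isT.
  have pick1 : reg s1 pick = rank v.
    by case: ks1 => -> //= _; rewrite /upd /= e_one pv subn1.
  run; apply: runs_write => ks; apply: Qv pv ks _.
  rewrite /= /upd /= e1_S pick1 e1_one.
  apply: (@layout_setS _ _ _ _ _ true) l1 _ => w; rewrite !inE.
  by case: eqVneq.
Qed.

Lemma setup_ok s (Q : state -> Prop) :
  (forall r, reg s r = 0) -> mem s 0 = n ->
  (forall s', env s' -> mem s' = mem s -> Q s') -> runs n setup s Q.
Proof.
move=> r0 m0 Qs; rewrite /setup; run.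
(* The square of [n] is built by repeated addition; [k * n] is the amount still missing from
   [baseS]. *)
pose J k s' := [/\ reg s' rounds = k, reg s' nN = n, reg s' one = 1,
  reg s' zero = 0 & reg s' baseS + k * n = 1 + n * n /\ mem s' = mem s].
apply: (@runs_while _ _ _ J n) => //.
- by move=> k s' [].
- move=> k s' _ [rk rn r1 rz [rS ms]]; run.
  split; rewrite /= /upd /= ?rk ?r1 ?subn1 //; split=> //.
  by rewrite rn -addnA -mulSn.
- by split; rewrite /= /upd /= ?r0 ?m0 ?addn0.
move=> s' [_ rn r1 rz [rS ms]]; run; apply: Qs => //.
rewrite mul0n addn0 in rS.
by split; rewrite /= /upd /= ?rS ?rn.
Qed.

(** The loop always makes [n] rounds. While some vertex is unabsorbed, a round adds a fresh vertex
    to [R]; afterwards [pick] is 0 and [S] stays unchanged. *)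
Lemma main_loop_ok s (Q : state -> Prop) :
  blue_condition D -> red_condition D ->
  env s -> layout set0 set0 (mem s) -> reg s rounds = n ->
  (forall s' S X, env s' -> layout S X (mem s') -> is_kernel D S -> Q s') ->
  runs n (While rounds (Seq (Sub rounds rounds one)
      (Seq find_unabsorbed (Seq find_red_sink do_exchange)))) s Q.
Proof.
move=> blueD redD es ls rs Qs.
pose J k s' := [/\ env s', reg s' rounds = k & exists S X R,
  [/\ layout S X (mem s'), semikernel D S R &
      unabsorbed D S = set0 \/ n <= #|R| + k]].
apply: (@runs_while _ _ _ J n) => //.
- by move=> k s' [].
- move=> k s0 _ [e0 r0 [S [X [R [l0 SR done]]]]].
  run; set s1 := set_reg _ _ _.
  have e1 : env s1 by [].
  have r1 : reg s1 rounds = k.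
    by case: e0 => _ e_one _ _ _; rewrite /= /upd /= r0 e_one subn1.
  apply: (find_unabsorbed_ok e1 l0) => s2 ks2 l2.
  have e2 := env_kept ks2 e1 isT.
  apply: runs_seq; apply: (find_red_sink_ok e2 l2) => s3 ks3 sink3.
  have e3 := env_kept ks3 e2 isT.
  have l3 : layout S (unabsorbed D S) (mem s3) by case: ks3 => _ ->.
  have r3 : reg s3 rounds = k by case: ks3 => -> // _; case: ks2 => ->.
  apply: (do_exchange_ok e3 l3) => [p0 | v s4 pv ks4 l4 |].
  + split=> //; exists S, (unabsorbed D S), R; split=> //; left.
    rewrite p0 in sink3; apply/eqP; apply: contraT.
    by move=> /(red_sink_exists blueD redD)[v]; rewrite (negPf (sink3 v)).
  + move: sink3; rewrite pv => -[v' /eqP]; rewrite rank_inj => /eqP<- sv.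
    split; [exact: env_kept ks4 e3 isT | by case: ks4 => -> |].
    exists (exchange D S v), (unabsorbed D S), (v |: R); split=> //.
      exact: semikernel_exchange.
    have [vU _] := red_sinkP _ _ _ sv.
    right; rewrite cardsU1 (semikernel_fresh SR vU) addnAC add1n addnC addnS.
    by case: done => [U0 | ]; [rewrite U0 inE in vU | rewrite addnS addnC].
  + by case: (reg s3 pick) sink3 => // m [v ->] _; apply: rank_lt.
- split=> //; exists set0, set0, set0; split=> //; first exact: semikernel0.
  by right; rewrite leq_addl.
- move=> s' [e' _ [S' [X' [R [l' SR done]]]]].
  apply: Qs e' l' _; apply: (semikernel_kernel SR).
  (* At counter 0 the bound forces [R] to contain every vertex, so no vertex is fresh. *)
  case: done => // leR; apply/setP=> x; rewrite [RHS]inE; apply/negP => xU.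
  have := semikernel_fresh SR xU.
  suff -> : R = setT by rewrite inE.
  by apply/eqP; rewrite eqEcard subsetT cardsT -[#|R|]addn0.
Qed.

Lemma output_ok S X s (Q : state -> Prop) : env s -> layout S X (mem s) ->
  (forall s', (forall u, mem s' (rank u) = (u \in S)) -> Q s') ->
  runs n output s Q.
Proof.
move=> es [_ mS _] Qs.
pose I k (m : nat -> nat) (a : nat) :=
  (forall u, m (1 + n * n + rank u) = (u \in S)) /\
  forall u, k <= rank u -> m (rank u) = (u \in S).
apply: (@runs_for _ _ tmp _ I) => //.
- by split=> // u; rewrite leqNgt rank_lt.
- move=> u s1 ks1 i1 _ [m1 out1].
  have [_ _ _ e_S _] := env_kept ks1 es isT.
  run; apply: runs_write; rewrite /= /upd /= e_S i1 m1; split=> w.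
    (* The output cells lie below [n], hence before the array of [S], which the copying therefore
       leaves intact. *)
    have nn : n <= n * n by rewrite leq_pmull // (leq_ltn_trans _ (rank_lt u)).
    rewrite gtn_eqF // (leq_trans (rank_lt u)) // (leq_trans nn) //.
    by rewrite addnAC leq_addl.
  rewrite leq_eqVlt !rank_inj.
  by case: eqVneq => [-> | _ /out1].
- by move=> s' _ [_ out]; apply: Qs => u; apply: out.
Qed.

Lemma nth_allpairs (T1 T2 T : Type) (f : T1 -> T2 -> T) x y z s t a b :
  a < size s -> b < size t ->
  nth z [seq f u v | u <- s, v <- t] (a * size t + b) = f (nth x s a) (nth y t b).
Proof.
elim: s a => // u s IHs [|a] lta ltb; rewrite allpairs_cons nth_cat size_map.
  by rewrite ltb (nth_map y).
by rewrite mulSn -addnA ltnNge leq_addr /= addKn IHs.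
Qed.

Lemma nth_rank v0 v : nth v0 (enum V) (rank v) = v.
Proof. by rewrite nth_enum_rank. Qed.

(** Cells behind the input hold 0, so both bit arrays already represent the empty set. *)
Lemma layout_initial : layout set0 set0 (nth 0 (encode D)).
Proof.
have sz : size (encode D) = 1 + n * n by rewrite /= size_allpairs -cardE.
split=> [u v | u | u]; last 2 first.
- by rewrite inE nth_default // sz leq_addr.
- by rewrite inE nth_default // sz -addnA leq_addr.
rewrite -addnA add1n /= {1}cardE (nth_allpairs _ u v) -?cardE ?rank_lt //.
by rewrite !nth_rank.
Qed.

Lemma encode_set_rank (S : {set V}) (m : nat -> nat) :
  (forall v, m (rank v) = (v \in S)) ->
  mkseq m (size (encode_set S)) = encode_set S.
Proof.
move=> mS; rewrite /encode_set size_map -cardE.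
apply: (@eq_from_nth _ 0) => [|a]; first by rewrite size_mkseq size_map -cardE.
rewrite size_mkseq => lta; rewrite nth_mkseq //.
pose v := enum_val (Ordinal lta).
have va : rank v = a by rewrite /rank enum_valK.
by rewrite (nth_map v) -?cardE // -va nth_rank mS.
Qed.

Lemma kernel_prog_ok : blue_condition D -> red_condition D ->
  exists2 S, is_kernel D S &
    outputs_within kernel_prog (encode D) (encode_set S) (cost n kernel_prog).
Proof.
move=> blueD redD.
suff [t [s [ex le [S kS out]]]] : runs n kernel_prog (initial_state (encode D))
    (fun s => exists2 S, is_kernel D S &
       mkseq (mem s) (size (encode_set S)) = encode_set S).
  by exists S => //; exists t, s.
apply: runs_seq; apply: setup_ok => // s1 e1 m1.
have [e_n _ e_zero _ _] := e1.
run.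
apply: main_loop_ok => //; first by rewrite /= m1; apply: layout_initial.
  by rewrite /= /upd /= e_n e_zero addn0.
move=> s3 S X e3 l3 kS; apply: (output_ok e3 l3) => s4 out.
by exists S => //; apply: encode_set_rank.
Qed.

End Correctness.

Theorem theorem1p1 :
  (forall (V : finType) (D : coldigraph V),
     blue_condition D -> red_condition D ->
     exists S : {set V}, is_kernel D S)
  /\
  (exists (p : cmd) (c k : nat),
     forall (V : finType) (D : coldigraph V),
       blue_condition D -> red_condition D ->
       exists S : {set V},
         is_kernel D S /\
         outputs_within p (encode D) (encode_set S) (c * digraph_size D ^ k + c)).
Proof.
split=> [V D blueD redD|].
  (* Mere existence is read off from the run of the program. *)
  by have [S kS _] := kernel_prog_ok blueD redD; exists S.
have [c [k cost_le]] := cost_poly kernel_prog.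
(* For nonempty [V], [#|V|.+1] is at most twice [digraph_size D], whence the factor [2 ^ k]; the
   additive constant covers empty [V]. *)
exists kernel_prog, (c * 2 ^ k), k => V D blueD redD.
have [S kS [t [s [ex out le]]]] := kernel_prog_ok blueD redD.
exists S; split=> //; exists t, s; split=> //.
apply: leq_trans le (leq_trans (cost_le _) _).
rewrite -mulnA -mulnDr leq_mul2l; apply/orP; right.
have leV : #|V| <= digraph_size D by apply: leq_addr.
have [V0 | V0] := posnP #|V|.
  by rewrite V0 exp1n (leq_trans _ (leq_addl _ _)) ?expn_gt0.
apply: leq_trans (leq_addr _ _); rewrite -expnMn.
case: {cost_le} k => // k; rewrite leq_exp2r // mul2n -addnn -addn1.
by rewrite leq_add // (leq_trans V0).
Qed.
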